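(* Let $G$ be a graph, $\mathcal T$ a nonempty set of triangles in $G$, and $\lambda=\lambda(\mathcal T)$. Then $G$ has a subgraph $H$, namely $H=\Gamma_0(\mathcal T)$, such that $|V(H)|\ge\lceil\lambda\rceil$, $d_{\min}(H)\ge\lceil\lambda\rceil-1$, and every edge of $H$ is contained in at least $\lceil\lambda\rceil-2$ triangles of $H$.
   Context: Fix a total order on $V(G)$. For a triangle $T=\{a,b,c\}$ with $a<b<c$ and an edge $e$, $[T:e]$ is $1$ if $e=\{a,b\}$ or $\{b,c\}$, $-1$ if $e=\{a,c\}$, $0$ if $e\not\subset T$. The support graph $\Gamma_0(\mathcal T)$ has vertex set $\bigcup_{T\in\mathcal T}T$ and edges the pairs contained in some member of $\mathcal T$. $\delta_{1,\mathcal T}$ is the $\mathcal T\times E(\Gamma_0(\mathcal T))$ matrix with entries $[T:e]$ and $\lambda(\mathcal T)$ is the smallest positive eigenvalue of $\delta_{1,\mathcal T}^T\delta_{1,\mathcal T}$. $d_{\min}$ denotes minimum degree. *)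

(* Defs.v *)
From HB Require Import structures.
From mathcomp Require Import all_boot all_order all_algebra.
From mathcomp Require Import complex reals.
From mathcomp Require classical_sets.

Set Implicit Arguments.
Unset Strict Implicit.
Unset Printing Implicit Defensive.

Import Order.TTheory GRing.Theory Num.Theory.
Local Open Scope ring_scope.

(* Finite simple graphs whose vertices are taken in an ambient finite type V,
   so that a subgraph may have fewer vertices than the graph. *)
Record sgraph (V : finType) := SGraph {
  vset : {set V};
  eset : {set {set V}};
  esetP : forall e, e \in eset -> e \subset vset /\ #|e| = 2%N }.

Section Graph.
Variable V : finType.
Implicit Types (G H : sgraph V) (T : {set {set V}}).

Definition subgraph H G : bool :=
  (vset H \subset vset G) && (eset H \subset eset G).

Definition neighbours G (v : V) : {set V} :=
  [set u in vset G | [set v; u] \in eset G].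

Definition degree G (v : V) : nat := #|neighbours G v|.

(* The default value #|vset G| bounds every degree, so it only matters when G
   has no vertex; see min_degreeP. *)
Definition min_degree G : nat :=
  \big[minn/#|vset G|]_(v in vset G) degree G v.

Definition triangles G : {set {set V}} :=
  [set t : {set V} | (#|t| == 3) &&
    [forall e : {set V}, (e \subset t) && (#|e| == 2) ==> (e \in eset G)]].

Definition support_eset T : {set {set V}} :=
  [set e : {set V} | (#|e| == 2) && [exists t in T, e \subset t]].

Lemma support_esetP T e : e \in support_eset T ->
  e \subset \bigcup_(t in T) t /\ #|e| = 2%N.
Proof.
rewrite inE => /andP[/eqP e2 /existsP[t /andP[tT et]]]; split=> //.
exact: subset_trans et (bigcup_sup t tT).
Qed.

Definition support_graph T : sgraph V :=
  SGraph (vset := \bigcup_(t in T) t) (@support_esetP T).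

Lemma min_degreeP G : vset G != set0 ->
  (exists2 v, v \in vset G & min_degree G = degree G v) /\
  (forall v, v \in vset G -> (min_degree G <= degree G v)%N).
Proof.
move=> /set0Pn[v0 v0G].
have le_min v : v \in vset G -> (min_degree G <= degree G v)%N.
  move=> vG; rewrite /min_degree; have := mem_index_enum v.
  elim: (index_enum V) => // x s IHs; rewrite inE big_cons.
  case/predU1P=> [<-|/IHs le_s]; first by rewrite vG geq_minl.
  by case: ifP => // _; rewrite geq_min le_s orbT.
split=> //; case: (arg_minnP (degree G) v0G) => v vG vmin.
exists v => //; apply/eqP; rewrite eqn_leq le_min //=.
rewrite /min_degree; elim/big_ind: _ => [|x y|i iG]; last exact: vmin.
  by apply/subset_leq_card/subsetP=> u; rewrite inE => /andP[].
by rewrite leq_min => -> ->.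
Qed.

End Graph.

(* The sign [t : e] of a pair e in a triangle t. *)
Definition tri_sign (R : pzRingType) d (V : finOrderType d) (t e : {set V}) : R :=
  if [exists a : V, exists b : V, exists c : V,
        [&& (a < b)%O, (b < c)%O, t == [set a; b; c]
          & (e == [set a; b]) || (e == [set b; c])]] then 1
  else if [exists a : V, exists b : V, exists c : V,
        [&& (a < b)%O, (b < c)%O, t == [set a; b; c] & e == [set a; c]]] then -1
  else 0.

Section Lambda.
Variables (R : realType) (d : Order.disp_t) (V : finOrderType d).
Implicit Type T : {set {set V}}.

Definition coboundary1 T : 'M[R]_(#|T|, #|eset (support_graph T)|) :=
  \matrix_(i, j) tri_sign R (enum_val i) (enum_val j).

Definition smallest_pos_eigenvalue n (A : 'M[R]_n) (a : R) : Prop :=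
  [/\ 0 < a, eigenvalue A a
    & forall b : R, 0 < b -> eigenvalue A b -> a <= b].

(* Equal to 0 when there is no positive eigenvalue, which does not happen for
   a nonempty set of triangles; see lambdaP. *)
Definition lambda T : R :=
  classical_sets.xget 0
    (smallest_pos_eigenvalue ((coboundary1 T)^T *m coboundary1 T)).

Lemma gram_smallest_pos_eigenvalue m n (B : 'M[R]_(m, n)) : B != 0 ->
  exists a, smallest_pos_eigenvalue (B^T *m B) a.
Proof.
move=> B0; set A := B^T *m B.
pose f : {rmorphism R -> R[i]} := real_complex R.
pose Ac := map_mx f A.
have Asym : A^T = A by rewrite /A trmx_mul trmxK.
have Ah : Ac \is hermsymmx.
  apply: realsym_hermsym.
    by apply/is_hermitianmxP; rewrite expr0 scale1r map_mx_id // map_trmx Asym.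
  by apply/mxOverP=> i j; rewrite mxE; apply/complex_realP; exists (A i j).
have Aeq := orthomx_spectralP (hermitian_normalmx Ah).
have Dreal := hermitian_spectral_diag_real Ah.
move: Aeq (spectral_unit Ac).
move: (spectralmx Ac) (spectral_diag Ac) Dreal => P D Dreal Aeq Pu.
have /all_sig[D' D'E] i : {x | D 0 i = f x}.
  exists (complex.Re (D 0 i)).
  by have /complex_realP[x ->] := mxOverP Dreal 0 i.
have eigE a : eigenvalue A a <-> exists i, D' i = a.
  rewrite -(eigenvalue_map f) -/Ac; split.
    case/eigenvalueP=> v vA v0.
    pose w := v *m invmx P.
    have w0 : w != 0.
      apply: contraNneq v0 => w0.
      by rewrite -[v](mulmxKV Pu) -/w w0 mul0mx.
    have wD : w *m diag_mx D = f a *: w.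
      by rewrite /w scalemxAl -vA [in RHS]Aeq -!mulmxA mulmxV // mulmx1.
    have [i wi] : exists i, w 0 i != 0.
      apply/existsP; apply: contraNT w0; rewrite negb_exists => /forallP w0.
      by apply/eqP/rowP=> i; apply/eqP; rewrite [X in _ == X]mxE -[_ == _]negbK.
    exists i; have /rowP/(_ i) := wD; rewrite mul_mx_diag mxE [RHS]mxE mulrC D'E.
    by move/(mulIf wi)/(fmorph_inj f).
  case=> i <-; apply/eigenvalueP; exists (row i P); last first.
    apply/negP=> /eqP Pi0; have := congr1 (mulmx^~ (invmx P)) Pi0.
    rewrite -row_mul mulmxV // mul0mx => /rowP/(_ i); rewrite !mxE eqxx.
    by move/eqP; rewrite oner_eq0.
  rewrite [in LHS]Aeq -row_mul !mulmxA mulmxV // mul1mx.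
  by rewrite row_mul row_diag_mx -scalemxAl -rowE D'E.
have trA : 0 < \sum_i D' i.
  have -> : \sum_i D' i = \tr A.
    apply: (fmorph_inj f); rewrite rmorph_sum -trace_map_mx -/Ac Aeq.
    rewrite -mulmxA mxtrace_mulC -mulmxA mulmxV // mulmx1 mxtrace_diag.
    by apply: eq_bigr => i _; rewrite D'E.
  have trE : \tr A = \sum_i \sum_j B j i ^+ 2.
    apply: eq_bigr => i _; rewrite mxE; apply: eq_bigr => j _.
    by rewrite mxE expr2.
  have sge0 i : 0 <= \sum_j B j i ^+ 2 by apply: sumr_ge0 => j _; exact: sqr_ge0.
  rewrite lt_neqAle trE sumr_ge0 // andbT eq_sym; apply: contra B0.
  rewrite psumr_eq0 // => /allP tr0; apply/eqP/matrixP=> j i; rewrite [RHS]mxE.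
  have := tr0 i (mem_index_enum _); rewrite psumr_eq0 /= => [/allP s0|k _];
    last exact: sqr_ge0.
  by have := s0 j (mem_index_enum _); rewrite /= sqrf_eq0 => /eqP.
have [i0 Di0] : exists i, 0 < D' i.
  apply/existsP; apply: contraLR trA; rewrite negb_exists -leNgt => /forallP D0.
  by apply: sumr_le0 => i _; rewrite leNgt.
case: (@Order.TotalTheory.arg_minP _ _ _ i0 (fun i => 0 < D' i) D' Di0) => i Di imin.
exists (D' i); split=> //; first by apply/eigE; exists i.
by move=> b b0 /eigE[j Dj]; rewrite -Dj in b0 *; exact: imin.
Qed.

Lemma lambdaP (G : sgraph V) T : T \subset triangles G -> T != set0 ->
  smallest_pos_eigenvalue ((coboundary1 T)^T *m coboundary1 T) (lambda T).
Proof.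
move=> /subsetP TG /set0Pn[t tT].
apply: classical_sets.xgetPex; apply: gram_smallest_pos_eigenvalue.
have := TG t tT; rewrite inE => /andP[/eqP t3 _].
have st : size (sort <=%O (enum t)) = 3 by rewrite size_sort -cardE.
have := sort_lt_sorted (enum t); rewrite enum_uniq.
have := mem_sort <=%O (enum t).
case: (sort _ _) st => [|a [|b [|c []]]] //= _ tE /and3P[ab bc _].
have tE' : t = [set a; b; c].
  by apply/setP=> x; rewrite !inE -orbA -mem_enum -tE !inE.
have eE : [set a; b] \in eset (support_graph T).
  rewrite inE cards2 (lt_eqF ab) /=; apply/existsP; exists t.
  by rewrite tT tE' subsetUl.
apply/eqP=> /matrixP/(_ (enum_rank_in tT t) (enum_rank_in eE [set a; b])).
rewrite !mxE !enum_rankK_in // /tri_sign ifT; last first.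
  apply/existsP; exists a; apply/existsP; exists b; apply/existsP; exists c.
  by rewrite ab bc tE' !eqxx.
by move/eqP; rewrite oner_eq0.
Qed.

End Lambda.

(* Main.v *)
Require Import Defs.
From mathcomp Require Import all_boot all_order all_algebra reals.
From mathcomp Require Import complex lra.
Set Implicit Arguments.
Unset Strict Implicit.
Unset Printing Implicit Defensive.
Import Order.TTheory GRing.Theory Num.Theory.
Local Open Scope ring_scope.

(** Let [B] be the coboundary matrix, [A = B^T B], and let [e] be an edge lying
    in [k > 0] triangles of [T].  Every eigenvalue [x] of [A] is [0] or at least
    [lam], so [lam * x <= x ^+ 2]; by the spectral theorem
    [lam * A e e <= (A ^+ 2) e e].  Here [A e e = k], and the remaining entries
    of row [e] of [A] are signs, nonzero exactly at the [2 k] other edges of the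
    triangles on [e], so [(A ^+ 2) e e = k ^+ 2 + 2 k] and [lam <= k + 2].
    The bounds on degrees and on the number of vertices follow by looking at the
    third vertices of the triangles on one edge. *)

(** * Sums of squares and spectra of Gram matrices *)

Lemma sqr_sum_orthogonal (R : comPzRingType) (I : finType) (F : I -> R) :
  (forall i j, i != j -> F i * F j = 0) -> (\sum_i F i) ^+ 2 = \sum_i F i ^+ 2.
Proof.
move=> F0; rewrite expr2 big_distrlr /=; apply: eq_bigr => i _.
by rewrite (bigD1 i) //= big1 ?addr0 ?expr2 // => j ji; rewrite F0 // eq_sym.
Qed.

(** If [v A = a v], then [a |v|^2 = |v B^T|^2], a sum of squares, while [|v|^2 > 0]. *)
Lemma gram_eigenvalue_ge0 (R : realFieldType) m n (B : 'M[R]_(m, n)) a :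
  eigenvalue (B^T *m B) a -> 0 <= a.
Proof.
have sqE p (w : 'rV[R]_p) : (w *m w^T) 0 0 = \sum_j w 0 j ^+ 2.
  by rewrite mxE; apply: eq_bigr => j _; rewrite mxE expr2.
have sq0 p (w : 'rV[R]_p) : 0 <= (w *m w^T) 0 0.
  by rewrite sqE sumr_ge0 // => j _; exact: sqr_ge0.
case/eigenvalueP=> v vA v0.
have vv : 0 < (v *m v^T) 0 0.
  rewrite lt_neqAle sq0 andbT eq_sym sqE.
  apply: contra v0; rewrite psumr_eq0 => [/allP s0|j _]; last exact: sqr_ge0.
  apply/eqP/rowP=> j; rewrite [RHS]mxE; apply/eqP.
  by have := s0 j (mem_index_enum _); rewrite /= sqrf_eq0.
have := sq0 _ (v *m B^T).
rewrite trmx_mul trmxK !mulmxA -(mulmxA v) vA -scalemxAl mxE.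
by rewrite pmulr_lge0.
Qed.

(** In a unitary eigenbasis both diagonal entries are sums over the eigenvalues [x j] with the same
    weights [|P j i|^2], one of [x j] and the other of its square, so they compare term by term. *)
Lemma smallest_pos_eigenvalue_gram (R : realType) m n (B : 'M[R]_(m, n)) a i :
  let A := B^T *m B in
  smallest_pos_eigenvalue A a -> a * A i i <= (A *m A) i i.
Proof.
move=> A [a0 _ amin].
pose f : {rmorphism R -> R[i]} := real_complex R.
pose Ac := map_mx f A.
have Asym : A^T = A by rewrite /A trmx_mul trmxK.
have Ah : Ac \is hermsymmx.
  apply: realsym_hermsym.
    by apply/is_hermitianmxP; rewrite expr0 scale1r map_mx_id // map_trmx Asym.
  by apply/mxOverP=> j k; rewrite mxE; apply/complex_realP; exists (A j k).
have Aeq := orthomx_spectralP (hermitian_normalmx Ah).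
have Dreal := hermitian_spectral_diag_real Ah.
move: Aeq (spectral_unitarymx Ac).
move: (spectralmx Ac) (spectral_diag Ac) Dreal => P D Dreal Aeq Pun.
have Pu := unitarymx_unit Pun.
have /all_sig[x xE] j : {x | D 0 j = f x}.
  exists (complex.Re (D 0 j)).
  by have /complex_realP[y ->] := mxOverP Dreal 0 j.
(* The rows of [P] are complex eigenvectors; being an eigenvalue descends from [Ac] to [A]. *)
have xeig j : eigenvalue A (x j).
  rewrite -(eigenvalue_map f) -/Ac; apply/eigenvalueP.
  exists (row j P); last first.
    apply/negP=> /eqP Pj0; have := congr1 (mulmx^~ (invmx P)) Pj0.
    rewrite -row_mul mulmxV // mul0mx => /rowP/(_ j); rewrite !mxE eqxx.
    by move/eqP; rewrite oner_eq0.
  rewrite [in LHS]Aeq -row_mul !mulmxA mulmxV // mul1mx.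
  by rewrite row_mul row_diag_mx -scalemxAl -rowE xE.
have ax j : a * x j <= x j ^+ 2.
  have := gram_eigenvalue_ge0 (xeig j); rewrite le_eqVlt => /predU1P[<-|xj0].
    by rewrite mulr0 expr0n.
  by rewrite expr2 ler_pM2r // amin.
(* The inverse of [P] is its conjugate transpose, which produces the weights. *)
have diagE (y : 'rV[R[i]]_n) :
    (invmx P *m diag_mx y *m P) i i = \sum_j `|P j i| ^+ 2 * y 0 j.
  rewrite mxE; apply: eq_bigr => j _.
  rewrite mul_mx_diag !mxE invmx_unitary // !mxE normCK.
  by rewrite mulrAC [_^* * _]mulrC.
have A2 : Ac *m Ac = invmx P *m diag_mx (\row_j D 0 j ^+ 2) *m P.
  rewrite [in LHS]Aeq !mulmxA mulmxK // -(mulmxA (invmx P) (diag_mx D)).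
  congr (_ *m _ *m _); apply/matrixP=> j k; rewrite mul_diag_mx !mxE.
  by case: eqP => [->|_]; rewrite ?mulr1n ?mulr0n ?mulr0 ?expr2.
rewrite -lecR -[X in X <= _]/(f _) -[X in _ <= X]/(f _) rmorphM.
have -> : f (A i i) = Ac i i by rewrite [RHS]mxE.
have -> : f ((A *m A) i i) = (Ac *m Ac) i i by rewrite -map_mxM [RHS]mxE.
rewrite A2 {1}Aeq !diagE mulr_sumr; apply: ler_sum => j _.
rewrite mxE mulrCA ler_wpM2l ?exprn_ge0 // xE -rmorphM -rmorphXn.
by rewrite lecR.
Qed.

(** * Triangles, their edges and signs *)

Lemma card3_sorted d (V : finOrderType d) (t : {set V}) : #|t| = 3%N ->
  exists a b c, [/\ (a < b)%O, (b < c)%O & t = [set a; b; c]].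
Proof.
move=> t3; have st : size (sort <=%O (enum t)) = 3 by rewrite size_sort -cardE.
have := sort_lt_sorted (enum t); rewrite enum_uniq.
have := mem_sort <=%O (enum t).
case: (sort _ _) st => [|a [|b [|c []]]] //= _ tE /and3P[ab bc _].
exists a, b, c; split=> //.
by apply/setP=> x; rewrite !inE -orbA -mem_enum -tE !inE.
Qed.

(** Squaring removes the vertex order and leaves only incidence. *)
Lemma tri_sign_sqr (R : pzRingType) d (V : finOrderType d) (t e : {set V}) :
  #|t| = 3%N -> #|e| = 2%N -> tri_sign R t e ^+ 2 = (e \subset t)%:R.
Proof.
move=> t3 e2; rewrite /tri_sign; case: ifPn => [|N1].
  case/existsP=> a /existsP[b /existsP[c /and4P[ab bc /eqP-> abc]]].
  suff -> : e \subset [set a; b; c] by rewrite expr1n.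
  by case/orP: abc => /eqP->; apply/subsetP=> z; rewrite !inE;
     case/orP=> ->; rewrite ?orbT.
case: ifPn => [|N2].
  case/existsP=> a /existsP[b /existsP[c /and4P[ab bc /eqP-> /eqP->]]].
  suff -> : [set a; c] \subset [set a; b; c] by rewrite sqrrN expr1n.
  by apply/subsetP=> z; rewrite !inE; case/orP=> ->; rewrite ?orbT.
(* When both tests fail, [e] is none of the three pairs of the sorted triangle. *)
suff -> : e \subset t = false by rewrite expr0n.
apply/negP=> et; have [a [b [c [ab bc tE]]]] := card3_sorted t3.
have {}N1 : (e != [set a; b]) && (e != [set b; c]).
  rewrite -negb_or; apply: contra N1 => ebc.
  apply/existsP; exists a; apply/existsP; exists b; apply/existsP; exists c.
  by rewrite ab bc tE eqxx.
have {}N2 : e != [set a; c].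
  apply: contra N2 => ebc.
  apply/existsP; exists a; apply/existsP; exists b; apply/existsP; exists c.
  by rewrite ab bc tE eqxx.
have /cards2P[x [y [xy eE]]] : #|e| == 2%N by apply/eqP.
have /subsetP et' := et.
have := et' x; have := et' y; rewrite eE !inE !eqxx orbT => /(_ isT) yt /(_ isT) xt.
move: xt yt xy N1 N2; rewrite eE tE !inE.
case/orP=> [/orP[]|] /eqP-> /orP[/orP[]|] /eqP->.
all: by rewrite ?eqxx // ?[[set b; a]]setUC ?[[set c; a]]setUC ?[[set c; b]]setUC
  ?eqxx ?andbF.
Qed.

(** Two distinct pairs have more than two points in their union, so they fill [t]. Hence two
    distinct edges share at most one triangle. *)
Lemma two_edges_triangle (V : finType) (t e f : {set V}) :
  #|t| = 3%N -> #|e| = 2%N -> #|f| = 2%N -> e != f -> e \subset t -> f \subset t ->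
  t = e :|: f.
Proof.
move=> t3 e2 f2 ef et ft; apply/esym/eqP; rewrite eqEcard subUset et ft t3 /=.
rewrite -e2; apply: proper_card; rewrite properE subsetUl subUset subxx /=.
by apply: contra ef => fe; rewrite eq_sym eqEcard fe e2 f2.
Qed.

(** * The eigenvalue bound at one edge *)

Lemma lambda_le_edge (R : realType) d (V : finOrderType d) (G : sgraph V)
    (T : {set {set V}}) (e : {set V}) :
  T \subset triangles G -> e \in eset (support_graph T) ->
  lambda R T <= (#|[set t in T | e \subset t]| + 2)%:R.
Proof.
move=> TG eE; set k := #|_|.
have E2 f : f \in eset (support_graph T) -> #|f| = 2%N.
  by rewrite inE => /andP[/eqP].
have T3 (i : 'I_#|T|) : #|enum_val i| = 3%N.
  by have := subsetP TG _ (enum_valP i); rewrite inE => /andP[/eqP].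
have E2v (l : 'I_#|eset (support_graph T)|) : #|enum_val l| = 2%N.
  exact: E2 (enum_valP l).
have [t0 t0T et0] : exists2 t, t \in T & e \subset t.
  by move: eE; rewrite inE => /andP[_ /existsP[t /andP[]]]; exists t.
have T0 : T != set0 by apply/set0Pn; exists t0.
have k0 : (0 < k)%N by apply/card_gt0P; exists t0; rewrite inE t0T.
set B := coboundary1 R T; set A := B^T *m B.
pose j := enum_rank_in eE e.
have jE : enum_val j = e by rewrite enum_rankK_in.
have B2 i l : B i l ^+ 2 = (enum_val l \subset enum_val i)%:R.
  by rewrite mxE tri_sign_sqr.
have Bsub i l : B i l != 0 -> enum_val l \subset enum_val i.
  by rewrite -sqrf_eq0 B2; case: (_ \subset _); rewrite // eqxx.
have AE l l' : A l l' = \sum_i B i l * B i l'.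
  by rewrite mxE; apply: eq_bigr => i _; rewrite mxE.
have Ajj : \sum_i B i j ^+ 2 = k%:R.
  under eq_bigr do rewrite B2 jE.
  rewrite -(big_enum_val (A := [in T]) (fun t => (e \subset t)%:R)) /=.
  rewrite -natr_sum /k -sum1dep_card big_mkcondr /=.
  by congr (_%:R); apply: eq_bigr => t _; case: ifP.
(* At most one triangle contains both edges, so all cross terms vanish. *)
have Ajl l : l != j -> A j l ^+ 2 = \sum_i B i j ^+ 2 * B i l ^+ 2.
  move=> lj; rewrite AE sqr_sum_orthogonal => [|i i' ii'].
    by apply: eq_bigr => i _; rewrite exprMn.
  apply/eqP; apply: contraNT ii'.
  rewrite !mulf_eq0 !negb_or => /andP[/andP[/Bsub ij /Bsub il]].
  case/andP=> /Bsub i'j /Bsub i'l; apply/eqP/enum_val_inj.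
  have jl : enum_val j != enum_val l.
    by rewrite (inj_eq enum_val_inj) eq_sym.
  rewrite (two_edges_triangle _ _ _ jl ij il) //.
  by rewrite -(two_edges_triangle _ _ _ jl i'j i'l).
have row3 i : \sum_l B i l ^+ 2 <= 3%:R.
  under eq_bigr do rewrite B2.
  rewrite -(big_enum_val (A := [in eset (support_graph T)])
    (fun f => (f \subset enum_val i)%:R)) /=.
  have := cards_draws (enum_val i) 2; rewrite T3 -[X in _ <= X%:R]/('C(3, 2)) => <-.
  rewrite -natr_sum ler_nat -sum1dep_card big_mkcond [leqRHS]big_mkcond /=.
  apply: leq_sum => f _; case: ifP => // fE.
  by rewrite (E2 f fE) eqxx andbT; case: (_ \subset _).
(* If triangle [i] contains [e], then [e] takes one of its at most three edges and leaves two;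
   otherwise both sides are 0. *)
have rest i : B i j ^+ 2 * (\sum_(l | l != j) B i l ^+ 2) <= B i j ^+ 2 * 2%:R.
  have := row3 i; rewrite (bigD1 j) //= B2; case: (_ \subset _) => /=; last first.
    by rewrite !mul0r.
  by lra.
have A2 : (A *m A) j j <= k%:R * (k%:R + 2%:R).
  have -> : (A *m A) j j = \sum_l A j l ^+ 2.
    rewrite mxE; apply: eq_bigr => l _; rewrite expr2; congr (_ * _).
    by rewrite !AE; apply: eq_bigr => i _; rewrite mulrC.
  rewrite (bigD1 j) //= AE; under [X in X ^+ 2]eq_bigr do rewrite -expr2.
  rewrite Ajj mulrDr -expr2 lerD2l; under eq_bigr => l lj do rewrite Ajl //.
  rewrite exchange_big /=; under eq_bigr do rewrite -mulr_sumr.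
  by rewrite -Ajj mulr_suml; apply: ler_sum.
(* This reads [lambda * k <= k * (k + 2)], and [k > 0] cancels. *)
have := le_trans (smallest_pos_eigenvalue_gram j (lambdaP R TG T0)) A2.
rewrite -/B -/A AE; under [X in _ * X]eq_bigr do rewrite -expr2.
by rewrite Ajj mulrC ler_pM2l ?ltr0n // natrD.
Qed.

(** * The support graph, degrees and third vertices *)

Lemma support_graph_sub (V : finType) (G : sgraph V) (T : {set {set V}}) :
  T \subset triangles G -> subgraph (support_graph T) G.
Proof.
move=> /subsetP TG.
have TE t (e : {set V}) :
    t \in T -> e \subset t -> #|e| = 2%N -> e \in eset G.
  move/TG; rewrite inE => /andP[_ /forallP/(_ e)/implyP eG] et e2.
  by apply: eG; rewrite et e2 eqxx.
apply/andP; split; last first.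
  by apply/subsetP=> e; rewrite inE => /andP[/eqP e2 /existsP[t /andP[tT et]]];
    exact: TE et e2.
apply/bigcupsP=> t tT; apply/subsetP=> x xt.
(* Membership in [triangles G] speaks of edges only, so [x] is placed in [vset G] through an edge to
   a second vertex of [t]. *)
have /card_gt0P[y] : (0 < #|t :\ x|)%N.
  have := TG _ tT; rewrite inE => /andP[/eqP t3 _].
  by move: t3; rewrite (cardsD1 x t) xt add1n => -[->].
rewrite !inE => /andP[yx yt].
have /esetP[/subsetP/(_ x)] : [set x; y] \in eset G.
  by apply: (TE t); rewrite ?cards2 1?eq_sym ?yx // subUset !sub1set xt.
by rewrite !inE eqxx => /(_ isT).
Qed.

(** Turns counts of members of [T] into lower bounds for counts in the support graph, which may have
    further triangles. *)
Lemma support_graph_triangles (V : finType) (G : sgraph V) (T : {set {set V}}) :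
  T \subset triangles G -> T \subset triangles (support_graph T).
Proof.
move=> /subsetP TG; apply/subsetP=> t tT.
have := TG _ tT; rewrite !inE => /andP[-> _] /=.
apply/forallP=> e; apply/implyP=> /andP[et e2]; rewrite inE e2.
by apply/existsP; exists t; rewrite tT.
Qed.

Lemma degree_ltn_card (V : finType) (G : sgraph V) v :
  v \in vset G -> (degree G v < #|vset G|)%N.
Proof.
move=> vG; apply: proper_card; apply/properP; split.
  by apply/subsetP=> u; rewrite inE => /andP[].
exists v => //; rewrite inE vG /=; apply/negP=> /esetP[_].
by rewrite setUid cards1.
Qed.

(** Each triangle on the edge is determined by its third vertex, a neighbour of [v] other than [u];
    the neighbour [u] itself makes the inequality strict. *)
Lemma edge_triangles_ltn_degree (V : finType) (G : sgraph V) u v :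
  [set v; u] \in eset G ->
  (#|[set t in triangles G | [set v; u] \subset t]| < degree G v)%N.
Proof.
move=> vuE; have [/subsetP vuG vu2] := esetP vuE.
have vu : v != u by move: vu2; rewrite cards2; case: eqP.
have adj t x : t \in triangles G -> v \in t -> x \in t -> x != v ->
    x \in neighbours G v.
  rewrite inE => /andP[_ /forallP/(_ [set v; x])/implyP tE] vt xt xv.
  have vxE : [set v; x] \in eset G.
    by apply: tE; rewrite subUset !sub1set vt xt cards2 (eq_sym v) xv.
  rewrite inE vxE andbT; have [/subsetP vxG _] := esetP vxE.
  by apply: vxG; rewrite !inE eqxx orbT.
have uN : u \in neighbours G v.
  by rewrite inE vuE andbT; apply: vuG; rewrite !inE eqxx orbT.
rewrite /degree (cardsD1 u) uN ltnS.
apply: leq_trans (leq_imset_card (fun w => w |: [set v; u]) _).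
apply/subset_leq_card/subsetP=> t; rewrite inE => /andP[tG vut].
have t3 : #|t| = 3%N by move: tG; rewrite inE => /andP[/eqP].
have /card_gt0P[w] : (0 < #|t :\: [set v; u]|)%N.
  by rewrite cardsDS // t3 cards2 vu.
rewrite !inE negb_or => /andP[/andP[wv wu] wt].
have vt : v \in t by apply: (subsetP vut); rewrite !inE eqxx.
apply/imsetP; exists w; first by rewrite in_setD1 wu (adj t).
apply/esym/eqP; rewrite eqEcard subUset sub1set wt vut t3.
by rewrite cardsU1 cards2 !inE negb_or wv wu vu.
Qed.

Theorem theorem3p3 (R : realType) (d : Order.disp_t) (V : finOrderType d)
    (G : sgraph V) (T : {set {set V}})
    (TG : T \subset triangles G) (T0 : T != set0) :
  let lam : R := lambda R T in
  let H := support_graph T in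
  [/\ subgraph H G,
      Num.ceil lam <= #|vset H|%:Z,
      Num.ceil lam - 1 <= (min_degree H)%:Z
    & forall e, e \in eset H ->
        Num.ceil lam - 2 <= #|[set t in triangles H | e \subset t]|%:Z].
Proof.
move=> lam H.
have edgeP e : e \in eset H ->
    Num.ceil lam <= (#|[set t in triangles H | e \subset t]| + 2)%:Z.
  move=> eH; rewrite ceil_le_int; apply: le_trans (lambda_le_edge R TG eH) _.
  rewrite ler_nat leq_add2r; apply/subset_leq_card/subsetP=> t.
  rewrite !(inE, in_setI) => /andP[tT ->]; rewrite andbT.
  by have := subsetP (support_graph_triangles TG) t tT; rewrite inE.
(* Every vertex of [H] lies on an edge of [H]. If that edge is in [m] triangles of [H], then
   [m < degree H v], so [m + 2] is at most [degree H v + 1]. *)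
have degP v : v \in vset H -> Num.ceil lam <= (degree H v).+1%:Z.
  case/bigcupP=> t tT vt; have := subsetP TG _ tT; rewrite inE => /andP[/eqP t3 _].
  have /card_gt0P[u] : (0 < #|t :\ v|)%N.
    by move: t3; rewrite (cardsD1 v t) vt add1n => -[->].
  rewrite !inE => /andP[uv ut].
  have vuH : [set v; u] \in eset H.
    rewrite inE cards2 (eq_sym v) uv; apply/existsP; exists t.
    by rewrite tT subUset !sub1set vt.
  apply: le_trans (edgeP _ vuH) _; rewrite lez_nat addn2 ltnS.
  exact: edge_triangles_ltn_degree.
have [v0 v0H] : exists v, v \in vset H.
  case/set0Pn: T0 => t tT; have := subsetP TG _ tT; rewrite inE => /andP[/eqP t3 _].
  have /card_gt0P[v vt] : (0 < #|t|)%N by rewrite t3.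
  by exists v; apply/bigcupP; exists t.
split.
- exact: support_graph_sub.
- by apply: le_trans (degP _ v0H) _; rewrite lez_nat degree_ltn_card.
(* As [H] has a vertex, the minimum is attained at some [v] and is not merely the default value. *)
- have [|[v vH ->] _] := @min_degreeP _ H; first by apply/set0Pn; exists v0.
  by rewrite lerBlDr -PoszD addn1 degP.
- by move=> e /edgeP; rewrite lerBlDr -PoszD.
Qed.
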